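(* There exists an absolute constant $c>0$ such that for every positive integer $k$ there exist a planar graph $G=(V,E,\ell)$ with nonnegative edge lengths (namely, the $k\times k$ grid with suitable edge lengths) and a set $R\subseteq V$ of $k$ terminals with the following property: every planar graph $H$ with nonnegative edge lengths such that $R\subseteq V(H)$ and $d_H(u,v)=d_G(u,v)$ for all $u,v\in R$ has at least $ck^2$ vertices. In particular, $f^*(k,\mathrm{Planar})\ge ck^2$, where $\mathrm{Planar}$ is the family of all planar graphs.
   Context: $d_H$ denotes shortest-path distance in a graph $H$ with respect to its edge lengths. Given a graph $G=(V,E,\ell)$ and terminals $R\subseteq V$, a distance-preserving minor of $G$ with respect to $R$ is a graph $G'$ with edge lengths $\ell'$ (which may differ from $\ell$) such that $G'$ is a minor of $G$ in which the terminals survive (terminals are never deleted and no two terminals are merged; a terminal may be merged with non-terminals by contraction and the resulting vertex is identified with that terminal), so $R\subseteq V(G')$, and $d_{G'}(u,v)=d_G(u,v)$ for all $u,v\in R$. For a family $\mathcal{F}$ of graphs, $f^*(k,\mathcal{F})$ is the minimum number such that every graph in $\mathcal{F}$, with any nonnegative edge lengths and any $k$ terminals, admits a distance-preserving minor with at most $f^*(k,\mathcal{F})$ vertices. *)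

(* Defs.v *)
From HB Require Import structures.
From mathcomp Require Import all_boot all_order all_algebra.
From mathcomp Require Import all_classical all_reals all_analysis.
Import numFieldNormedType.Exports.
Import Order.TTheory GRing.Theory Num.Theory.

Set Implicit Arguments.
Unset Strict Implicit.
Unset Printing Implicit Defensive.

Local Open Scope classical_set_scope.
Local Open Scope ring_scope.

Record sgraph := SGraph {
  vertex :> finType;
  edge : rel vertex;
  edge_sym : symmetric edge;
  edge_irr : irreflexive edge }.
Arguments edge {_}.

(* Edge lengths are given as a function on ordered pairs of vertices; its
   values on pairs of non-adjacent vertices are irrelevant. *)
Definition edge_length (R : realType) (G : sgraph) (l : G -> G -> R) : Prop :=
  forall x y : G, edge x y -> l x y = l y x /\ 0 <= l x y.

(* The vertices of the path are x followed by those of p. *)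
Definition path_length (R : realType) (G : sgraph) (l : G -> G -> R)
    (x : G) (p : seq G) : R :=
  \sum_(a <- pairmap l x p) a.

(* The infimum is over a finite set, hence a minimum, unless no path joins
   x to y, in which case the distance is +oo. *)
Definition dist (R : realType) (G : sgraph) (l : G -> G -> R) (x y : G) :
    \bar R :=
  ereal_inf [set (path_length l x p)%:E | p in
    [set p : seq G | [/\ path edge x p, uniq (x :: p) & last x p = y]]].

(* The inclusion of the terminals S in V(H) is represented by an injection. *)
Definition preserves_dist (R : realType) (G : sgraph) (l : G -> G -> R)
    (S : {set G}) (H : sgraph) (l' : H -> H -> R)
    (iota : {x : G | x \in S} -> H) : Prop :=
  injective iota /\
  forall u v : {x : G | x \in S},
    dist l' (iota u) (iota v) = dist l (val u) (val v).

(* Topological plane drawing: each edge is a simple arc joining its ends,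
   with interior free of vertices and of points of the other edges (common
   endpoints of arcs are vertices, so it is enough to compare interiors).
   The arc of an edge is parametrised in both directions. *)
Definition plane_drawing (R : realType) (G : sgraph)
    (pos : G -> R * R) (arc : G -> G -> R -> R * R) : Prop :=
  [/\ injective pos,
      forall x y : G, edge x y ->
        [/\ {within `[0, 1], continuous (arc x y)},
            {in `[0, 1] &, injective (arc x y)},
            arc x y 0 = pos x, arc x y 1 = pos y
          & forall t : R, t \in `[0, 1] -> arc y x t = arc x y (1 - t)],
      forall x y z : G, edge x y ->
        forall t : R, t \in `]0, 1[ -> arc x y t <> pos z
    & forall x y x' y' : G, edge x y -> edge x' y' ->
        [set x; y]%SET <> [set x'; y']%SET ->
        forall s t : R, s \in `]0, 1[ -> t \in `]0, 1[ ->
        arc x y s <> arc x' y' t].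

Definition planar (R : realType) (G : sgraph) : Prop :=
  exists (pos : G -> R * R) (arc : G -> G -> R -> R * R),
    plane_drawing pos arc.

Definition grid_edge (k : nat) : rel ('I_k * 'I_k) :=
  fun u v =>
    (u.1 == v.1) && ((u.2.+1 == v.2 :> nat) || (v.2.+1 == u.2 :> nat)) ||
    (u.2 == v.2) && ((u.1.+1 == v.1 :> nat) || (v.1.+1 == u.1 :> nat)).

Lemma grid_edge_sym k : symmetric (@grid_edge k).
Proof.
move=> u v; rewrite /grid_edge [v.1 == u.1]eq_sym [v.2 == u.2]eq_sym.
by rewrite [(v.2.+1 == _ :> nat) || _]orbC [(v.1.+1 == _ :> nat) || _]orbC.
Qed.

Lemma grid_edge_irr k : irreflexive (@grid_edge k).
Proof. by move=> u; rewrite /grid_edge !eqxx !eqn_leq !ltnn. Qed.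

Definition grid (k : nat) : sgraph :=
  SGraph (@grid_edge_sym k) (@grid_edge_irr k).

(* G' is a minor of G with branch sets [phi^-1 (Some x')]: the vertices sent to
   None are deleted, each branch set is contracted to a single vertex. *)
Definition minor_map (G G' : sgraph) (phi : G -> option G') : Prop :=
  [/\ forall x' : G', exists x : G, phi x = Some x',
      forall (x' : G') (x y : G), phi x = Some x' -> phi y = Some x' ->
        connect [rel u v | [&& edge u v, phi u == Some x' & phi v == Some x']]
          x y
    & forall x' y' : G', edge x' y' ->
        exists x y : G, [/\ edge x y, phi x = Some x' & phi y = Some y']].

(* The vertex of G' identified with a terminal u is [iota u], the contraction
   of the branch set containing u. *)
Definition dp_minor (R : realType) (G : sgraph) (l : G -> G -> R)
    (S : {set G}) (G' : sgraph) (l' : G' -> G' -> R) : Prop :=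
  edge_length l' /\
  exists (phi : G -> option G') (iota : {x : G | x \in S} -> G'),
    [/\ minor_map phi, forall u, phi (val u) = Some (iota u)
      & preserves_dist l l' iota].

Definition has_dp_minors (R : realType) (F : sgraph -> Prop) (k N : nat) :
    Prop :=
  forall (G : sgraph) (l : G -> G -> R) (S : {set G}),
    F G -> edge_length l -> #|S| = k ->
    exists (G' : sgraph) (l' : G' -> G' -> R),
      dp_minor l S l' /\ (#|vertex G'| <= N)%N.

(* The minimum of a set of natural numbers, with value +oo if it is empty. *)
Definition fstar (R : realType) (F : sgraph -> Prop) (k : nat) : \bar R :=
  ereal_inf [set (N%:R : R)%:E | N in [set N | has_dp_minors R F k N]].

(* Main.v *)
(** The terminals sit on or next to the boundary of the unit-length [k * k] grid,
    whose metric is the l1 distance. If shortest walks between the pairs [u, v]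
    and [u', v'] share a vertex, exchanging their tails gives
    [d u u' + d v v' <= d u v + d u' v'] and [d u v' + d v u' <= d u v + d u' v'];
    this fails in the l1 metric when the bounding boxes of the two pairs are
    separated by a line. So in any graph H realising the terminal distances, the
    "rows" are pairwise disjoint, and so are the "columns". If a row missed a
    column, then together with the corner terminals they would give nine walks of
    a K_{3,3} of which no two independent ones meet, which planarity forbids.
    Choosing a vertex on each row and column gives quadratically many vertices.

    That planarity forbids it is proved by counting crossings mod 2: sample the
    nine curves finely and let [step_cross] count the crossings of L-shaped steps.
    This count is a coboundary, so its sum over the 18 independent pairs depends
    on the end points only, and equals 1; but it vanishes for disjoint compact
    curves once the sampling is finer than their distance. *)

Require Import Defs.
From HB Require Import structures.
From mathcomp Require Import all_boot all_order all_algebra.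
From mathcomp Require Import all_classical all_reals all_analysis.
From mathcomp Require Import zify ring lra.
Import numFieldNormedType.Exports.
Import Order.TTheory GRing.Theory Num.Theory.

Set Implicit Arguments.
Unset Strict Implicit.
Unset Printing Implicit Defensive.

Local Open Scope classical_set_scope.
Local Open Scope ring_scope.

(** * Parity of crossings *)

Fixpoint chain_sum (T : Type) (f : T -> T -> bool) (x : T) (s : seq T) : bool :=
  if s is y :: s' then f x y (+) chain_sum f y s' else false.

Lemma chain_sumD (T : Type) (f g : T -> T -> bool) (x : T) (s : seq T) :
  chain_sum (fun p q => f p q (+) g p q) x s =
  chain_sum f x s (+) chain_sum g x s.
Proof.
by elim: s x => //= y s IHs x; rewrite IHs addbACA.
Qed.

Lemma eq_chain_sum (T : Type) (f g : T -> T -> bool) (x : T) (s : seq T) :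
  (forall p q, f p q = g p q) -> chain_sum f x s = chain_sum g x s.
Proof. by move=> fg; elim: s x => //= y s IHs x; rewrite fg IHs. Qed.

Lemma chain_sum_telescope (T : Type) (f : T -> bool) (x : T) (s : seq T) :
  chain_sum (fun p q => f p (+) f q) x s = f x (+) f (last x s).
Proof.
elim: s x => [|y s IHs] x /=; first by rewrite addbb.
by rewrite IHs -addbA addKb.
Qed.

Section CrossingParity.
Variables (T : eqType) (X Y : rel T).

(* The parity of the number of crossings of two steps p -> p' and q -> q', each
   drawn as a segment along the first axis followed by one along the second,
   when X and Y compare the first and the second coordinates. *)
Definition step_cross (p p' q q' : T) : bool :=
  (X p q' (+) X p' q') && (Y p q (+) Y p q')
  (+) (X p' q (+) X p' q') && (Y p q (+) Y p' q).

Definition cross (x : T) (s : seq T) (y : T) (r : seq T) : bool :=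
  chain_sum (fun p p' => chain_sum (step_cross p p') y r) x s.

(** With [X] and [Y] the coordinate orders: whether the L-shaped step from [q] to [q'] crosses the
    vertical ray going up from [p]. *)
Definition turn (p q q' : T) : bool := (X p q (+) X p q') && Y p q.

(** Likewise, whether the step from [p] to [p'] crosses the vertical ray going down from [q]. *)
Definition turn' (q p p' : T) : bool := (X p q (+) X p' q) && Y p q.

(* step_cross is a coboundary on the product of the two chains, so only the
   boundary of the product contributes. *)
Lemma cross_boundary (x : T) (s : seq T) (y : T) (r : seq T) :
  cross x s y r =
  (chain_sum (turn x) y r (+) chain_sum (turn (last x s)) y r)
  (+) (chain_sum (turn' y) x s (+) chain_sum (turn' (last y r)) x s).
Proof.
have stepE p p' q q' : step_cross p p' q q' =
    (turn p q q' (+) turn p' q q') (+) (turn' q p p' (+) turn' q' p p').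
  rewrite /step_cross /turn /turn'.
  by case: (X p q) (X p' q) (X p q') (X p' q') => [] [] [] [];
    case: (Y p q) (Y p' q) (Y p q') (Y p' q') => [] [] [] [].
transitivity (chain_sum (fun p p' =>
    (chain_sum (turn p) y r (+) chain_sum (turn p') y r)
    (+) (turn' y p p' (+) turn' (last y r) p p')) x s).
  apply: eq_chain_sum => p p'.
  rewrite (eq_chain_sum _ _ (stepE p p')) chain_sumD.
  congr (_ (+) _); first exact: chain_sumD.
  exact: (chain_sum_telescope (fun q => turn' q p p')).
rewrite chain_sumD; congr (_ (+) _); last exact: chain_sumD.
exact: (chain_sum_telescope (fun p => chain_sum (turn p) y r)).
Qed.

Hypothesis X_antisym : forall p q, p != q -> X q p = ~~ X p q.
Hypothesis Y_antisym : forall p q, p != q -> Y q p = ~~ Y p q.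

(** The rays up and down from [q] make up a vertical line, which a chain avoiding [q] crosses an odd
    number of times exactly when its ends lie on different sides. *)
Lemma chain_sum_turn' (q x : T) (s : seq T) : q \notin x :: s ->
  chain_sum (turn' q) x s =
  chain_sum (turn q) x s (+) (X q x (+) X q (last x s)).
Proof.
elim: s x => [|y s IHs] x; first by rewrite /= addbb.
rewrite inE negb_or => /andP[qx qs] /=; rewrite IHs //.
have qy : q != y by move: qs; rewrite inE negb_or => /andP[].
rewrite /turn /turn' (X_antisym qx) (X_antisym qy) (Y_antisym qx).
by case: (X q x) (X q y) (Y q x) (X q (last y s)) (chain_sum (turn q) y s)
  => [] [] [] [] [].
Qed.

(** Turning the downward rays into upward ones leaves ray terms of a single kind, one end point
    against one chain, which can then cancel between different pairs of chains. *)
Lemma cross_disjoint (x : T) (s : seq T) (y : T) (r : seq T) :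
  {in x :: s & y :: r, forall p q, p != q} ->
  cross x s y r =
  (chain_sum (turn x) y r (+) chain_sum (turn (last x s)) y r)
  (+) (chain_sum (turn y) x s (+) chain_sum (turn (last y r)) x s)
  (+) (X y x (+) X y (last x s) (+) (X (last y r) x (+) X (last y r) (last x s))).
Proof.
move=> sr; rewrite cross_boundary.
have disj q : q \in y :: r -> q \notin x :: s.
  by move=> qr; apply/negP => /sr/(_ qr); rewrite eqxx.
rewrite !chain_sum_turn' ?disj ?mem_last ?mem_head //.
move: (chain_sum _ _ r) (chain_sum _ _ r) (chain_sum _ _ s) (chain_sum _ _ s).
move: (X (last y r) (last x s)) (X y x) (X y (last x s)) (X (last y r) x).
by do 8!case.
Qed.

(** Sum [cross_disjoint] over the 18 independent pairs of edges. The ray term of an end point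
    against an edge avoiding it occurs twice, once for each edge at that end point independent of
    the given one. Comparisons involving some [A i] also occur an even number of times. Each pair
    [B j], [B j'] is compared in both directions three times over, contributing 9 in all, which is
    odd. *)
Lemma k33_cross (A B : 'I_3 -> T) (g : 'I_3 -> 'I_3 -> seq T) :
  (forall i j, last (A i) (g i j) = B j) ->
  (forall i i' j j', i != i' -> j != j' ->
    {in A i :: g i j & A i' :: g i' j', forall p q, p != q}) ->
  exists i i' j j', [/\ i != i', j != j' & cross (A i) (g i j) (A i') (g i' j')].
Proof.
move=> gB disj; apply: contrapT => no_cross.
pose Fa i i' j := chain_sum (turn (A i)) (A i') (g i' j).
pose Fb j i' j' := chain_sum (turn (B j)) (A i') (g i' j').
(* Parity is expressed by an equation between naturals, so that the summation can be left to
   [lia]. *)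
have cross0 i i' j j' : i != i' -> j != j' ->
    exists n : nat, (Fa i i' j' + Fb j i' j' + (Fa i' i j + Fb j' i j)
      + (X (A i') (A i) + X (A i') (B j) + (X (B j') (A i) + X (B j') (B j)))
      = n + n)%N.
  move=> ii' jj'.
  have : cross (A i) (g i j) (A i') (g i' j') = false.
    by apply/negP => c; apply: no_cross; exists i, i', j, j'.
  rewrite (cross_disjoint (disj i i' j j' ii' jj')) !gB.
  rewrite -/(Fa i i' j') -/(Fb j i' j') -/(Fa i' i j) -/(Fb j' i j).
  move=> /negbT ev.
  suff even n : ~~ odd n -> exists m, n = (m + m)%N.
    by apply: even; move: ev; rewrite !oddD !oddb.
  by exists n./2; rewrite addnn even_halfK.
pose i0 : 'I_3 := inord 0; pose i1 : 'I_3 := inord 1; pose i2 : 'I_3 := inord 2.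
have [i01 i02 i12] : [/\ i0 != i1, i0 != i2 & i1 != i2].
  by rewrite -!val_eqE /= !inordK.
have [i10 i20 i21] : [/\ i1 != i0, i2 != i0 & i2 != i1].
  by rewrite !(eq_sym i1) !(eq_sym i2).
have XB j j' : j != j' -> (X (B j) (B j') + X (B j') (B j) = 1)%N.
  move=> jj'.
  have : B j != B j'.
    by apply: (disj i0 i1 j j') => //;
      [rewrite -(gB i0 j)|rewrite -(gB i1 j')]; apply: mem_last.
  by move=> /X_antisym ->; case: (X _ _).
have := XB _ _ i12; have := XB _ _ i02; have := XB _ _ i01.
(* The 18 pairs: [i < i'] in three ways, combined with every ordered pair of distinct [j], [j']. *)
have [n0] := cross0 _ _ _ _ i01 i01.
have [n1] := cross0 _ _ _ _ i01 i02.
have [n2] := cross0 _ _ _ _ i01 i12.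
have [n3] := cross0 _ _ _ _ i01 i10.
have [n4] := cross0 _ _ _ _ i01 i20.
have [n5] := cross0 _ _ _ _ i01 i21.
have [n6] := cross0 _ _ _ _ i02 i01.
have [n7] := cross0 _ _ _ _ i02 i02.
have [n8] := cross0 _ _ _ _ i02 i12.
have [n9] := cross0 _ _ _ _ i02 i10.
have [n10] := cross0 _ _ _ _ i02 i20.
have [n11] := cross0 _ _ _ _ i02 i21.
have [n12] := cross0 _ _ _ _ i12 i01.
have [n13] := cross0 _ _ _ _ i12 i02.
have [n14] := cross0 _ _ _ _ i12 i12.
have [n15] := cross0 _ _ _ _ i12 i10.
have [n16] := cross0 _ _ _ _ i12 i20.
have [n17] := cross0 _ _ _ _ i12 i21.
repeat match goal with
  |- context [nat_of_bool ?b] => generalize (nat_of_bool b); intro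
end.
clear; intros.
lia.
Qed.
End CrossingParity.

(** * Chains of points in the plane *)

Section Plane.
Variable R : realType.

(* Ties are broken by the other coordinate, so that distinct points are always
   comparable and no general position assumption is needed. *)
Definition ltX : rel (R * R) :=
  fun p q => (p.1 < q.1) || (p.1 == q.1) && (p.2 < q.2).

Definition ltY : rel (R * R) := fun p q => ltX (p.2, p.1) (q.2, q.1).

Definition near_points (e : R) : rel (R * R) :=
  fun p q => (`|p.1 - q.1| < e) && (`|p.2 - q.2| < e).

Lemma ltX_antisym (p q : R * R) : p != q -> ltX q p = ~~ ltX p q.
Proof.
case: p q => [p1 p2] [q1 q2]; rewrite -pair_eqE /pair_eq /ltX /=.
by case: (ltgtP p1 q1) => //=; case: (ltgtP p2 q2).
Qed.

Lemma ltY_antisym (p q : R * R) : p != q -> ltY q p = ~~ ltY p q.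
Proof.
move=> pq; apply: ltX_antisym; move: pq.
by case: p q => [p1 p2] [q1 q2]; rewrite -!pair_eqE /pair_eq /= andbC.
Qed.

(** Steps shorter than [e] preserve the order in a coordinate where [p] and [q] differ by at least
    [e + e], and each product in [step_cross] has as a factor a difference of comparisons in that
    coordinate. *)
Lemma step_cross_far (e : R) (p p' q q' : R * R) :
  near_points e p p' -> near_points e q q' -> ~~ near_points (e + e) p q ->
  step_cross ltX ltY p p' q q' = false.
Proof.
case: p p' q q' => [p1 p2] [p1' p2'] [q1 q2] [q1' q2'].
rewrite /near_points /=.
move=> /andP[+ +] /andP[+ +].
rewrite ![`|_| < e]ltr_norml => /andP[a1 a2] /andP[a3 a4] /andP[b1 b2] /andP[b3 b4].
rewrite negb_and -!leNgt !ler_normr => /orP[] /orP[] dist_pq.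
- suff E u v : u \in [:: (p1, p2); (p1', p2')] -> v \in [:: (q1, q2); (q1', q2')] ->
      ltX u v = false.
    by rewrite /step_cross !E ?inE ?eqxx ?orbT.
  rewrite !inE /ltX => /orP[] /eqP -> /orP[] /eqP -> /=;
  by apply/negP => /orP[|/andP[/eqP]]; lra.
- suff E u v : u \in [:: (p1, p2); (p1', p2')] -> v \in [:: (q1, q2); (q1', q2')] ->
      ltX u v = true.
    by rewrite /step_cross !E ?inE ?eqxx ?orbT.
  rewrite !inE /ltX => /orP[] /eqP -> /orP[] /eqP -> /=;
  by apply/orP; left; lra.
- suff E u v : u \in [:: (p1, p2); (p1', p2')] -> v \in [:: (q1, q2); (q1', q2')] ->
      ltY u v = false.
    by rewrite /step_cross !E ?inE ?eqxx ?orbT ?andbF.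
  rewrite !inE /ltY /ltX => /orP[] /eqP -> /orP[] /eqP -> /=;
  by apply/negP => /orP[|/andP[/eqP]]; lra.
- suff E u v : u \in [:: (p1, p2); (p1', p2')] -> v \in [:: (q1, q2); (q1', q2')] ->
      ltY u v = true.
    by rewrite /step_cross !E ?inE ?eqxx ?orbT ?andbF.
  rewrite !inE /ltY /ltX => /orP[] /eqP -> /orP[] /eqP -> /=;
  by apply/orP; left; lra.
Qed.

Lemma cross_far (e : R) (x : R * R) (s : seq (R * R)) (y : R * R) (r : seq (R * R)) :
  path (near_points e) x s -> path (near_points e) y r ->
  {in x :: s & y :: r, forall p q, ~~ near_points (e + e) p q} ->
  cross ltX ltY x s y r = false.
Proof.
rewrite /cross => xs yr; elim: s x xs => [//|x' s IHs] x /= /andP[xx' x's] far.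
rewrite IHs //; last by move=> p q ps qr; apply: far; rewrite // inE ps orbT.
rewrite addbF.
have {far IHs x's} far : {in y :: r, forall q, ~~ near_points (e + e) x q}.
  by move=> q qr; apply: far; rewrite // mem_head.
elim: r y yr far => [//|y' r IHr] y /= /andP[yy' y'r] far.
rewrite IHr //; last by move=> q qr; apply: far; rewrite inE qr orbT.
by rewrite addbF (step_cross_far xx' yy') // far // mem_head.
Qed.

(** * Compactness and the sampling of arcs *)

(** Two distinct points stay apart under small displacements; the near-covering form of compactness
    of the product makes the bound uniform. *)
Lemma compact_separated (K L : set (R * R)) : compact K -> compact L ->
  K `&` L = set0 ->
  \forall e \near 0^'+, forall p q, K p -> L q -> ~~ near_points e p q.
Proof.
move=> cK cL KL.
pose P (e : R) (pq : (R * R) * (R * R)) := ~~ near_points e pq.1 pq.2.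
suff : \forall e \near 0^'+, (K `*` L) `<=` P e.
  by apply: filterS => e KLe p q Kp Lq; exact: (KLe (p, q)).
have /compact_near_coveringP := compact_setX cK cL; apply.
move=> [[p1 p2] [q1 q2]] /= [Kp Lq].
(* The factor 4 absorbs a displacement below [d] of each of the two points and a tolerance
   [e < d]. *)
have [d [d0 dP]] : exists d : R, 0 < d /\ (4 * d <= `|p1 - q1| \/ 4 * d <= `|p2 - q2|).
  have [p1q1|p1q1] := eqVneq p1 q1; last first.
    exists (`|p1 - q1| / 4); rewrite divr_gt0 ?normr_gt0 ?subr_eq0 //.
    by split=> //; left; lra.
  have [p2q2|p2q2] := eqVneq p2 q2; last first.
    exists (`|p2 - q2| / 4); rewrite divr_gt0 ?normr_gt0 ?subr_eq0 //.
    by split=> //; right; lra.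
  suff : (K `&` L) (p1, p2) by rewrite KL.
  by split=> //; rewrite p1q1 p2q2.
exists (ball ((p1, p2), (q1, q2)) d, [set e | e < d]) => /=.
  by split; [exact: nbhsx_ballx|exact: nbhs_right_lt].
move=> [[[p1' p2'] [q1' q2']] e] /= [[[]]].
rewrite /ball /= => a1 a2 [b1 b2] ed; apply/negP => /andP[/= c1 c2].
move: a1 a2 b1 b2 c1 c2; rewrite /ball /=.
rewrite !ltr_norml => /andP[a1 a2] /andP[a3 a4] /andP[b1 b2] /andP[b3 b4].
move=> /andP[c1 c2] /andP[c3 c4].
by case: dP; rewrite ler_normr => /orP[]; lra.
Qed.

(** The Heine-Cantor theorem, by near-covering compactness of the unit interval. *)
Lemma arc_unif (f : R -> R * R) (e : R) : {within `[0, 1], continuous f} -> 0 < e ->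
  \forall d \near 0^'+, forall t : R, `[0, 1]%classic t -> forall u : R, `[0, 1]%classic u ->
    `|t - u| < d -> near_points e (f t) (f u).
Proof.
move=> /subspace_continuousP cf e0.
pose P (d t : R) := `[0, 1]%classic t -> forall u : R, `[0, 1]%classic u ->
    `|t - u| < d -> near_points e (f t) (f u).
have /compact_near_coveringP := @segment_compact R 0 1.
move=> /(_ _ _ P _) cov.
suff : \forall d \near 0^'+, `[0, 1]%classic `<=` P d.
  by apply: filterS => d dP t t01; exact: (dP t t01 t01).
apply: cov => t t01.
  have e2 : 0 < e / 2 by rewrite divr_gt0.
  have /cvg_ballP/(_ _ e2) := cf t t01.
  rewrite !near_withinE => /nbhs_ballP[d /= d0 dP].
  exists (ball t (d / 2), [set x | x < d / 2]) => /=.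
    split; first by apply: nbhsx_ballx; rewrite divr_gt0.
    by apply: nbhs_right_lt; rewrite divr_gt0.
  move=> [u x] /= [tu xd] u01 v v01 uv.
  have /dP/(_ u01) [/= fu1 fu2] : ball t d u by rewrite /ball /= in tu *; lra.
  have /dP/(_ v01) [/= fv1 fv2] : ball t d v.
    rewrite /ball /= in tu *.
    have -> : t - v = (t - u) + (u - v) by ring.
    by rewrite (le_lt_trans (ler_normD _ _)) //; lra.
  apply/andP; rewrite /ball /= in fu1 fu2 fv1 fv2.
  have -> : (f u).1 - (f v).1 = ((f t).1 - (f v).1) - ((f t).1 - (f u).1) by ring.
  have -> : (f u).2 - (f v).2 = ((f t).2 - (f v).2) - ((f t).2 - (f u).2) by ring.
  by split; rewrite (le_lt_trans (ler_normB _ _)) //; lra.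
Qed.

(** Sample the arc at the multiples of [1 / (n + 1)], a mesh below the modulus of uniform
    continuity. *)
Lemma arc_chain (f : R -> R * R) (e : R) : {within `[0, 1], continuous f} -> 0 < e ->
  exists s, [/\ path (near_points e) (f 0) s, last (f 0) s = f 1
    & {in s, forall p, (f @` `[0, 1]) p}].
Proof.
move=> cf e0.
have : \forall d \near 0^'+, forall t : R, `[0, 1]%classic t -> forall u : R, `[0, 1]%classic u ->
    `|t - u| < d -> near_points e (f t) (f u) by exact: arc_unif.
move=> unif.
have [d [d0 dP]] : exists d : R, 0 < d /\ forall t : R, `[0, 1]%classic t -> forall u : R, `[0, 1]%classic u ->
    `|t - u| < d -> near_points e (f t) (f u).
  by near (0 : R)^'+ => d; exists d; split; [near: d; exact: nbhs_right_gt|near: d].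
have [n nd] : exists n : nat, n.+1%:R^-1 < d.
  by near \oo => n; exists n; near: n; exact: near_infty_natSinv_lt (PosNum d0).
suff chain k : (k <= n.+1)%N -> exists s, [/\ path (near_points e) (f 0) s,
    last (f 0) s = f (k%:R / n.+1%:R) & {in s, forall p, (f @` `[0, 1]) p}].
  by have [s] := chain n.+1 (leqnn _); rewrite divff ?pnatr_eq0 //; exists s.
have k01 k' : (k' <= n.+1)%N -> `[0, 1]%classic (k'%:R / n.+1%:R : R).
  by move=> k'n; rewrite /= in_itv /= divr_ge0 //= ler_pdivrMr // mul1r ler_nat.
elim: k => [_|k IHk kn]; first by exists [::]; rewrite mul0r.
have [s [fs sk sf]] := IHk (ltnW kn).
exists (rcons s (f (k.+1%:R / n.+1%:R))); split.
- rewrite rcons_path fs sk; apply: dP; [exact: k01 (ltnW kn)|exact: k01|].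
  rewrite -mulrBl -natr1 opprD addrA subrr add0r mulN1r normrN ger0_norm //.
- by rewrite last_rcons.
- move=> p; rewrite mem_rcons inE => /orP[/eqP ->|/sf //].
  by exists (k.+1%:R / n.+1%:R) => //; exact: k01.
Unshelve. all: end_near. Qed.
End Plane.

(** * Plane drawings and K_{3,3} *)

(* The vertices need not be distinct nor the walks simple, so that the property
   passes to minors by lifting walks through the branch sets. *)
Definition k33_free (G : sgraph) : Prop :=
  forall (A B : 'I_3 -> G) (p : 'I_3 -> 'I_3 -> seq G),
    (forall i j, path edge (A i) (p i j)) ->
    (forall i j, last (A i) (p i j) = B j) ->
    exists i i' j j', [/\ i != i', j != j'
      & has (mem (A i :: p i j)) (A i' :: p i' j')].

Section Drawing.
Variables (R : realType) (G : sgraph) (pos : G -> R * R).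
Variable arc : G -> G -> R -> R * R.
Hypothesis drawing : plane_drawing pos arc.

Fixpoint walk_set (x : G) (p : seq G) : set (R * R) :=
  if p is y :: p' then (arc x y @` `[0, 1]) `|` walk_set y p' else [set pos x].

Lemma compact_walk_set (x : G) (p : seq G) :
  path edge x p -> compact (walk_set x p).
Proof.
elim: p x => [|y p IHp] x /=; first by move=> _; exact: compact_set1.
move=> /andP[xy yp]; apply: compactU; last exact: IHp.
apply: continuous_compact; last exact: segment_compact.
by have [_ /(_ x y xy)[]] := drawing.
Qed.

Lemma walk_set_chain (x : G) (p : seq G) (e : R) : path edge x p -> 0 < e ->
  exists s, [/\ path (near_points e) (pos x) s, last (pos x) s = pos (last x p)
    & {in pos x :: s, forall z, walk_set x p z}].
Proof.
move=> xp e0; elim: p x xp => [|y p IHp] x /=.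
  by move=> _; exists [::]; split=> // z; rewrite inE => /eqP.
move=> /andP[xy /IHp[s [ps sy sp]]].
have [_ /(_ x y xy)[carc _ arc0 arc1 _] _ _] := drawing.
have [r [pr ry rp]] := arc_chain carc e0.
exists (r ++ s); rewrite cat_path last_cat -arc0 pr ry arc1 ps sy; split=> // z.
rewrite inE mem_cat => /or3P[/eqP ->|/rp|zs]; [|by left|].
  by left; exists 0 => //=; rewrite in_itv /= lexx ler01.
by right; apply: sp; rewrite inE zs orbT.
Qed.

(** The ends of arcs are counted as vertices, since [plane_drawing] states its disjointness
    conditions for the interiors of arcs. *)
Lemma walk_setP (x : G) (p : seq G) (z : R * R) : path edge x p ->
  walk_set x p z ->
  (exists2 u, u \in x :: p & z = pos u) \/
  (exists u v (t : R), [/\ u \in x :: p, v \in x :: p, edge u v, t \in `]0, 1[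
     & z = arc u v t]).
Proof.
elim: p x => [|y p IHp] x /=; first by move=> _ ->; left; exists x; rewrite ?mem_head.
move=> /andP[xy yp] [[t t01 <-]|/(IHp _ yp)[[u up ->]|[u [v [t [up vp uv t01 ->]]]]]].
- have [_ /(_ x y xy)[_ _ arc0 arc1 _] _ _] := drawing.
  have [->|t0] := eqVneq t 0; first by left; exists x; rewrite ?mem_head.
  have [->|t1] := eqVneq t 1; first by left; exists y; rewrite // inE mem_head orbT.
  have tI : t \in `]0, 1[.
    move: t01; rewrite /= !in_itv /= => /andP[t_ge0 t_le1].
    by rewrite !lt_neqAle t_ge0 t_le1 t1 eq_sym t0.
  by right; exists x, y, t; rewrite !inE !eqxx orbT.
- by left; exists u; rewrite // inE up orbT.
- by right; exists u, v, t; rewrite inE up inE vp !orbT.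
Qed.

Lemma walk_set_disjoint (x y : G) (p q : seq G) : path edge x p -> path edge y q ->
  ~~ has (mem (x :: p)) (y :: q) -> walk_set x p `&` walk_set y q = set0.
Proof.
move=> xp yq /hasPn pq; apply/seteqP; split=> // z [/(walk_setP xp) zp /(walk_setP yq) zq].
have neq u v : u \in x :: p -> v \in y :: q -> u <> v.
  by move=> up /pq + uv; rewrite -uv /= up.
have [pos_inj _ vertex_free edge_free] := drawing.
case: zp zq => [[u up ->]|[u [u' [t [up u'p uu' t01 ->]]]]].
  move=> [[v vq /pos_inj]|[v [v' [s [vq v'q vv' s01]]]]]; first exact: neq.
  by move/esym; exact: vertex_free.
move=> [[v vq]|[v [v' [s [vq v'q vv' s01]]]]]; first exact: vertex_free.
(* The two edges differ: [u] is on the first walk, while [v] and [v'] are on the second. *)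
apply: edge_free => // /setP/(_ u); rewrite !inE eqxx /=.
by move/esym/orP => [] /eqP; exact: neq.
Qed.

End Drawing.

(** Otherwise independent walks trace disjoint compact curves. The finitely many pairs share one
    positive separation, and fine samples then do not cross by [cross_far], against [k33_cross]. *)
Lemma planar_k33_free (R : realType) (G : sgraph) : planar R G -> k33_free G.
Proof.
move=> [pos [arc drawing]] A B p Ap pB; apply: contrapT => no_meet.
have disj i i' j j' : i != i' -> j != j' ->
    walk_set pos arc (A i) (p i j) `&` walk_set pos arc (A i') (p i' j') = set0.
  move=> ii' jj'; apply: (walk_set_disjoint drawing) => //; apply/negP => meet.
  by apply: no_meet; exists i, i', j, j'.
pose indep (k : ('I_3 * 'I_3) * ('I_3 * 'I_3)) := (k.1.1 != k.2.1) && (k.1.2 != k.2.2).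
pose W (ij : 'I_3 * 'I_3) := walk_set pos arc (A ij.1) (p ij.1 ij.2).
have far : \forall e \near (0 : R)^'+, forall k, indep k ->
    forall z w, W k.1 z -> W k.2 w -> ~~ near_points e z w.
  apply: filter_forall => k; have [/andP[ii' jj']|nk] := boolP (indep k); last first.
    exact: nearW.
  have /compact_separated sep := compact_walk_set drawing (Ap k.1.1 k.1.2).
  have := sep _ (compact_walk_set drawing (Ap k.2.1 k.2.2)) (disj _ _ _ _ ii' jj').
  by apply: filterS => e eP _; exact: eP.
have [e [e0 {}far]] : exists e : R, 0 < e /\ forall k, indep k ->
    forall z w, W k.1 z -> W k.2 w -> ~~ near_points e z w.
  by near (0 : R)^'+ => e; exists e; split; [near: e; exact: nbhs_right_gt|near: e].
(* Half the separation, since [cross_far] asks for chains that are twice the step size apart. *)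
have e20 : 0 < e / 2 by rewrite divr_gt0.
have [g gP] := choice (fun ij : 'I_3 * 'I_3 =>
  walk_set_chain drawing (Ap ij.1 ij.2) e20).
have far_g i i' j j' : i != i' -> j != j' ->
    {in pos (A i) :: g (i, j) & pos (A i') :: g (i', j'),
      forall z w, ~~ near_points (e / 2 + e / 2) z w}.
  move=> ii' jj' z w zg wg; rewrite -splitr; apply: (far ((i, j), (i', j'))).
  - exact/andP.
  - by have [_ _] := gP (i, j); exact.
  - by have [_ _] := gP (i', j'); exact.
have [i j|i i' j j' ii' jj' z w zg wg|i [i' [j [j' [ii' jj']]]]] :=
  @k33_cross _ (@ltX R) (@ltY R) (@ltX_antisym R) (@ltY_antisym R)
    (pos \o A) (pos \o B) (fun i j => g (i, j)).
- by have [_ -> _] := gP (i, j); rewrite /= pB.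
- apply: contraNneq (far_g _ _ _ _ ii' jj' _ _ zg wg) => ->.
  by rewrite /near_points !subrr normr0 -splitr e0.
- rewrite (cross_far _ _ (far_g _ _ _ _ ii' jj')) //.
  + by have [] := gP (i, j).
  + by have [] := gP (i', j').
Unshelve. all: end_near. Qed.

(** * Walks lifted through minors *)

(** Each vertex is replaced by a walk within its branch set, each edge by an edge of [G] between the
    two branch sets. *)
Lemma minor_walk (G G' : sgraph) (phi : G -> option G') (x' : G') (p' : seq G')
    (x y : G) :
  minor_map phi -> path edge x' p' -> phi x = Some x' ->
  phi y = Some (last x' p') ->
  exists p, [/\ path edge x p, last x p = y
    & {in x :: p, forall z, exists2 z', z' \in x' :: p' & phi z = Some z'}].
Proof.
move=> [_ conn adj].
have branch u v w : phi u = Some w -> phi v = Some w -> exists p, [/\ path edge u p,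
    last u p = v & {in u :: p, forall z, phi z = Some w}].
  move=> uw vw; have /connectP[p up ->] := conn w u v uw vw; exists p; split=> //.
    by apply: sub_path up => ? ? /and3P[].
  elim: p u uw up {vw} => [|a p IHp] u uw /=; first by move=> _ z; rewrite inE => /eqP ->.
  move=> /andP[/and3P[_ _ /eqP aw] ap] z; rewrite inE => /orP[/eqP -> //|].
  exact: IHp.
elim: p' x' x => [|a' p' IHp] x' x /=.
  move=> _ xx' yx'; have [p [xp py pw]] := branch x y x' xx' yx'.
  by exists p; split=> // z /pw; exists x'; rewrite ?mem_head.
move=> /andP[x'a' a'p'] xx' yl.
have [u [v [uv ux' va']]] := adj _ _ x'a'.
have [p [xp pu pw]] := branch x u x' xx' ux'.
have [q [vq qy qw]] := IHp a' v a'p' va' yl.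
exists (p ++ v :: q); rewrite cat_path last_cat /= xp pu uv vq; split=> // z.
rewrite -cat_cons mem_cat => /orP[/pw|/qw[z' z'p]].
  by exists x'; rewrite ?mem_head.
by exists z'; rewrite // inE z'p orbT.
Qed.

(** A common vertex of two lifted walks lies in a single branch set, and the vertex of [G'] it
    stands for is on both original walks. *)
Lemma minor_k33_free (G G' : sgraph) (phi : G -> option G') :
  minor_map phi -> k33_free G -> k33_free G'.
Proof.
move=> minor free A' B' p' Ap' pB'.
have [sec secP] := choice (let: And3 surj _ _ := minor in surj).
have lift (ij : 'I_3 * 'I_3) : exists p, [/\ path edge (sec (A' ij.1)) p,
    last (sec (A' ij.1)) p = sec (B' ij.2)
    & {in sec (A' ij.1) :: p, forall z, exists2 z', z' \in A' ij.1 :: p' ij.1 ij.2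
        & phi z = Some z'}].
  by apply: minor_walk minor _ _ _; rewrite ?secP ?pB'.
have [g gP] := choice lift.
have [||i [i' [j [j' [ii' jj' /hasP[z zg' zg]]]]]] :=
  free (sec \o A') (sec \o B') (fun i j => g (i, j)).
- by move=> i j; have [] := gP (i, j).
- by move=> i j; have [] := gP (i, j).
exists i, i', j, j'; split=> //.
have [_ _ /(_ z zg)[w wp zw]] := gP (i, j).
have [_ _ /(_ z zg')[w' w'p]] := gP (i', j').
by rewrite zw => -[ww']; apply/hasP; exists w; rewrite // ww'.
Qed.

(** * Walks and distances *)

Section Walks.
Variables (R : realType) (G : sgraph) (l : G -> G -> R).
Hypothesis l_length : edge_length l.

Lemma path_length_cons (x y : G) (p : seq G) :
  path_length l x (y :: p) = l x y + path_length l y p.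
Proof. by rewrite /path_length /= big_cons. Qed.

Lemma path_length_cat (x : G) (p q : seq G) :
  path_length l x (p ++ q) = path_length l x p + path_length l (last x p) q.
Proof.
elim: p x => [|y p IHp] x /=; first by rewrite {2}/path_length big_nil add0r.
by rewrite !path_length_cons IHp addrA.
Qed.

Lemma path_length_ge0 (x : G) (p : seq G) : path edge x p -> 0 <= path_length l x p.
Proof.
elim: p x => [|y p IHp] x /=; first by rewrite /path_length big_nil.
by move=> /andP[/l_length[_ l0] /IHp]; rewrite path_length_cons; apply: addr_ge0.
Qed.

(** [dist] ranges over simple paths. Cutting closed subwalks out of a walk does not lengthen it, so
    any walk bounds the distance. *)
Lemma uniq_walk (x : G) (p : seq G) : path edge x p ->
  exists q, [/\ path edge x q, uniq (x :: q), last x q = last x p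
    & path_length l x q <= path_length l x p].
Proof.
elim: p x => [|y p IHp] x /=; first by exists [::].
move=> /andP[xy /IHp[q [yq uq qp lqp]]].
have [_ l0] := l_length xy; rewrite path_length_cons.
have [xq|xq] := boolP (x \in y :: q); last first.
  exists (y :: q); rewrite xq uq /= xy yq path_length_cons.
  by split=> //; rewrite lerD2l.
case/splitPl: xq yq uq qp lqp => q1 q2 q1x; rewrite cat_path last_cat q1x.
move=> /andP[yq1 xq2] uq qp; rewrite path_length_cat q1x => lqp.
exists q2; split=> //; last by have := path_length_ge0 yq1; lra.
move: uq; rewrite -cat_cons cat_uniq => /and3P[_ /hasPn xq2' uq2].
rewrite uq2 andbT; apply/negP => /xq2'.
by rewrite /= -q1x mem_last.
Qed.

Lemma dist_le_walk (x y : G) (p : seq G) : path edge x p -> last x p = y ->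
  (dist l x y <= (path_length l x p)%:E)%E.
Proof.
move=> xp py; have [q [xq uq qp lqp]] := uniq_walk xp.
apply: (@le_trans _ _ (path_length l x q)%:E); last by rewrite lee_fin.
by apply: ereal_inf_lbound; exists q => //; split; rewrite ?qp.
Qed.

Lemma walk_of_dist (x y : G) (a : R) : (dist l x y < a%:E)%E ->
  exists p, [/\ path edge x p, last x p = y & path_length l x p < a].
Proof.
by move=> /ereal_inf_lt[_ [p [xp _ py] <-]]; rewrite lte_fin; exists p.
Qed.

Lemma rev_walk (x : G) (p : seq G) : path edge x p ->
  exists q, [/\ path edge (last x p) q, last (last x p) q = x
    & path_length l (last x p) q = path_length l x p].
Proof.
elim: p x => [|y p IHp] x /=; first by exists [::].
move=> /andP[xy /IHp[q [pq qy lq]]]; have [lxy _] := l_length xy.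
exists (q ++ [:: x]); rewrite cat_path last_cat path_length_cat pq qy lq /=.
rewrite edge_sym xy !path_length_cons /path_length big_nil; split=> //.
by rewrite addr0 -lxy addrC.
Qed.

Lemma split_walk (x : G) (p : seq G) (z : G) : path edge x p -> z \in x :: p ->
  exists p1 p2, [/\ path edge x p1, last x p1 = z, path edge z p2,
    last z p2 = last x p & path_length l x p1 + path_length l z p2 = path_length l x p].
Proof.
move=> xp zp; case/splitPl: zp xp => p1 p2 p1z; rewrite cat_path p1z => /andP[xp1 zp2].
by exists p1, p2; rewrite path_length_cat last_cat p1z.
Qed.

(* Exchange the two walks at a common vertex. *)
Lemma meeting_walks (x x' y y' : G) (p p' : seq G) (a b : R) :
  path edge x p -> last x p = y -> path edge x' p' -> last x' p' = y' ->
  has (mem (x :: p)) (x' :: p') ->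
  (a%:E <= dist l x x')%E && (b%:E <= dist l y y')%E
  || (a%:E <= dist l x y')%E && (b%:E <= dist l y x')%E ->
  a + b <= path_length l x p + path_length l x' p'.
Proof.
move=> xp py x'p' p'y' /hasP[z zp' zp].
have [p1 [p2 [xp1 p1z zp2 p2y <-]]] := split_walk xp zp.
have [q1 [q2 [x'q1 q1z zq2 q2y' <-]]] := split_walk x'p' zp'.
have [r1 [zr1 r1x' <-]] := rev_walk x'q1.
have [r2 [yr2 r2z <-]] := rev_walk zp2.
rewrite q1z in zr1 r1x' *; rewrite p2y py in yr2 r2z *; rewrite p'y' in q2y'.
have xx' := @dist_le_walk x x' (p1 ++ r1).
have yy' := @dist_le_walk y y' (r2 ++ q2).
have xy' := @dist_le_walk x y' (p1 ++ q2).
have yx' := @dist_le_walk y x' (r2 ++ r1).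
move: xx' yy' xy' yx'; rewrite !cat_path !last_cat !path_length_cat !p1z !r2z.
rewrite xp1 yr2 zr1 zq2 => /(_ isT r1x') xx' /(_ isT q2y') yy'.
move=> /(_ isT q2y') xy' /(_ isT r1x') yx'.
case/orP => /andP[]; [move=> /le_trans/(_ xx') + /le_trans/(_ yy')
  | move=> /le_trans/(_ xy') + /le_trans/(_ yx')]; rewrite !lee_fin; lra.
Qed.

End Walks.

(** * The l1 metric and separated boxes *)

Definition nat_dist (u v : nat) : nat := ((u - v) + (v - u))%N.

Definition distl1 (u v : nat * nat) : nat :=
  (nat_dist u.1 v.1 + nat_dist u.2 v.2)%N.

Definition intervals_apart (u v u' v' : nat) : bool :=
  (maxn u v < minn u' v')%N || (maxn u' v' < minn u v)%N.

Definition boxes_apart (u v u' v' : nat * nat) : bool :=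
  intervals_apart u.1 v.1 u'.1 v'.1 || intervals_apart u.2 v.2 u'.2 v'.2.

(** The four-point condition of tree metrics, for points on a line. *)
Lemma nat_dist_four_point (u v u' v' : nat) :
  (nat_dist u v + nat_dist u' v' <= nat_dist u u' + nat_dist v v')%N
  || (nat_dist u v + nat_dist u' v' <= nat_dist u v' + nat_dist v u')%N.
Proof. rewrite /nat_dist; lia. Qed.

(** Either exchanged pairing traverses the gap between the intervals twice, and between naturals the
    gap is at least 1. *)
Lemma nat_dist_intervals_apart (u v u' v' : nat) : intervals_apart u v u' v' ->
  (nat_dist u v + nat_dist u' v' + 2 <= nat_dist u u' + nat_dist v v')%N
  && (nat_dist u v + nat_dist u' v' + 2 <= nat_dist u v' + nat_dist v u')%N.
Proof.
rewrite /intervals_apart /nat_dist !gtn_max !leq_min => /orP[] /and3P[]; lia.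
Qed.

(** The separating coordinate gains 2 in both exchanged pairings; choose the one that loses nothing
    in the other coordinate. *)
Lemma distl1_boxes_apart (u v u' v' : nat * nat) : boxes_apart u v u' v' ->
  (distl1 u v + distl1 u' v' + 2 <= distl1 u u' + distl1 v v')%N
  || (distl1 u v + distl1 u' v' + 2 <= distl1 u v' + distl1 v u')%N.
Proof.
case: u v u' v' => [u1 u2] [v1 v2] [u1' u2'] [v1' v2'].
rewrite /distl1 => /orP[] /= /nat_dist_intervals_apart /andP[].
  by have /orP[] := nat_dist_four_point u2 v2 u2' v2'; lia.
by have /orP[] := nat_dist_four_point u1 v1 u1' v1'; lia.
Qed.

(** * Rows and columns *)

(* The right-hand column of terminals is n.-1, not n, and the first row is 1, not 0,
   to leave room for a walk from (n, n) to (0, 0) through (0, n). *)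
Definition frame (n m : nat) : seq (nat * nat) :=
  [:: (0, 0); (0, n); (n, 0); (n, n)]%N ++
  flatten [seq [:: (i, 0); (i, n.-1); (1, i); (n, i)]%N | i <- iota 2 m].

Section Frame.
Variables (R : realType) (H : sgraph) (l : H -> H -> R).
Variables (n m : nat) (h : nat * nat -> H).
Hypothesis l_length : edge_length l.
Hypothesis mn : (m + 3 <= n)%N.
Hypothesis h_dist : forall u v, u \in frame n m -> v \in frame n m ->
  dist l (h u) (h v) = (distl1 u v)%:R%:E.

Lemma frame_side (i : nat) : (2 <= i < m + 2)%N ->
  {subset [:: (i, 0); (i, n.-1); (1, i); (n, i)]%N <= frame n m}.
Proof.
move=> im u ui; rewrite mem_cat; apply/orP; right; apply/flatten_mapP.
by exists i; rewrite // mem_iota addnC.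
Qed.

(** An excess below 1 per walk suffices, as separated boxes yield a surplus of 2. Membership in the
    frame is placed under the existential so that [geod] is total; off the frame the empty walk is
    the default. *)
Lemma near_geodesic (u v : nat * nat) : exists p,
  u \in frame n m -> v \in frame n m ->
  [/\ path edge (h u) p, last (h u) p = h v
    & path_length l (h u) p < (distl1 u v)%:R + 1].
Proof.
have [/andP[uT vT]|uvT] := boolP ((u \in frame n m) && (v \in frame n m)).
  have : (dist l (h u) (h v) < ((distl1 u v)%:R + 1)%:E)%E.
    by rewrite h_dist // lte_fin ltrDl.
  by move=> /walk_of_dist[p pP]; exists p.
by exists [::] => uT vT; rewrite uT vT in uvT.
Qed.

Let geod (u v : nat * nat) : seq H := projT1 (cid (near_geodesic u v)).

Let geodP (u v : nat * nat) : u \in frame n m -> v \in frame n m ->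
  [/\ path edge (h u) (geod u v), last (h u) (geod u v) = h v
    & path_length l (h u) (geod u v) < (distl1 u v)%:R + 1].
Proof. exact: (projT2 (cid (near_geodesic u v))). Qed.

(** Two such walks together exceed the two distances by less than 2, whereas by [meeting_walks] a
    common vertex would force an excess of at least 2. *)
Lemma geod_apart (u v u' v' : nat * nat) (z : H) :
  all (mem (frame n m)) [:: u; v; u'; v'] ->
  z \in h u :: geod u v -> z \in h u' :: geod u' v' -> ~~ boxes_apart u v u' v'.
Proof.
move=> /and5P[/= uT vT u'T v'T _] zp zp'.
apply/negP => /distl1_boxes_apart far.
have [up pv lp] := geodP uT vT; have [u'p' p'v' lp'] := geodP u'T v'T.
have meet : has (mem (h u :: geod u v)) (h u' :: geod u' v') by apply/hasP; exists z.
have lt2 (s : nat) : (distl1 u v + distl1 u' v' + 2 <= s)%N ->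
    path_length l (h u) (geod u v) + path_length l (h u') (geod u' v') < s%:R.
  by rewrite -(ler_nat R) 2!natrD => le_s; lra.
have key := meeting_walks l_length up pv u'p' p'v' meet.
case/orP: far => /lt2; rewrite natrD ltNge => /negP; apply; apply: key;
  by rewrite !h_dist // !lexx ?orbT.
Qed.

Fixpoint tour (u : nat * nat) (ws : seq (nat * nat)) : seq H :=
  if ws is v :: ws' then geod u v ++ tour v ws' else [::].

Lemma tour_path (u : nat * nat) (ws : seq (nat * nat)) :
  all (mem (frame n m)) (u :: ws) ->
  path edge (h u) (tour u ws) /\ last (h u) (tour u ws) = h (last u ws).
Proof.
elim: ws u => [//|v ws IHws] u /= /andP[uT vT]; have [pv vl] := IHws v vT.
have [up pv' _] := geodP uT (andP vT).1.
by rewrite cat_path last_cat pv' up pv.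
Qed.

Lemma mem_tour (u v : nat * nat) (ws : seq (nat * nat)) (z : H) :
  all (mem (frame n m)) [:: u, v & ws] -> z \in h u :: tour u (v :: ws) ->
  has (fun s => z \in h s.1 :: geod s.1 s.2) (zip (u :: v :: ws) (v :: ws)).
Proof.
elim: ws u v => [|w ws IHws] u v T; first by rewrite /= cats0 orbF.
rewrite -[tour _ _]/(geod u v ++ tour v (w :: ws)) -cat_cons mem_cat.
case/andP: T => uT vT /orP[zuv|zw]; first by rewrite /= zuv.
apply/orP; right; apply: (IHws v w vT).
by rewrite inE zw orbT.
Qed.

Lemma geod_cross (i j : nat) : k33_free H ->
  (2 <= i < m + 2)%N -> (2 <= j < m + 2)%N ->
  exists z, z \in h (i, 0%N) :: geod (i, 0%N) (i, n.-1) /\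
            z \in h (1%N, j) :: geod (1%N, j) (n, j).
Proof.
move=> free im jm.
have T0 u : u \in [:: (0, 0); (0, n); (n, 0); (n, n); (i, 0); (i, n.-1); (1, j); (n, j)]%N ->
    u \in frame n m.
  have [iT jT] := (frame_side im, frame_side jm).
  move=> uC; rewrite !inE in uC; case/or4P: uC => [/eqP->|/eqP->|/eqP->|/or4P[/eqP->|/eqP->|/eqP->|/orP[]/eqP->]];
    first [by rewrite !inE !eqxx ?orbT
       |by apply: iT; rewrite !inE !eqxx ?orbT|by apply: jT; rewrite !inE !eqxx ?orbT].
(* The walk from (n, n) to (0, 0) is led through the corner (0, n), and the one
   from (i, 0) to (n, j) through (n, 0): every independent pair but the wanted
   one then consists of near-geodesics in separated boxes. *)
pose start := [:: (i, 0); (1, j); (n, n)]%N.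
pose route := [:: [:: [:: (0, 0)];         [:: (i, n.-1)]; [:: (n, 0); (n, j)]];
                  [:: [:: (0, 0)];         [:: (i, n.-1)]; [:: (n, j)]];
                  [:: [:: (0, n); (0, 0)]; [:: (i, n.-1)]; [:: (n, j)]]]%N.
pose a (x : 'I_3) := nth (0, 0)%N start x.
pose b (y : 'I_3) := nth (0, 0)%N [:: (0, 0); (i, n.-1); (n, j)]%N y.
pose ws (x y : 'I_3) := nth [::] (nth [::] route x) y.
have T x y : all (mem (frame n m)) (a x :: ws x y).
  case: x y => [[|[|[|//]]] ?] [[|[|[|//]]] ?];
  rewrite /a /ws /=; do ?[apply/andP; split=> //]; by apply: T0; rewrite !inE !eqxx ?orbT.
have nseg x y : exists v vs, ws x y = v :: vs.
  by case: x y => [[|[|[|//]]] ?] [[|[|[|//]]] ?]; rewrite /ws /=; do 2!eexists.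
pose segs x y := zip (a x :: ws x y) (ws x y).
have on_seg x y z : z \in h (a x) :: tour (a x) (ws x y) ->
    exists2 s, s \in segs x y & z \in h s.1 :: geod s.1 s.2.
  have [v [vs wsE]] := nseg x y; have := T x y; rewrite /segs wsE => Txy zt.
  exact/hasP/(mem_tour Txy).
have seg_frame x y : {in segs x y, forall s, (s.1 \in frame n m) && (s.2 \in frame n m)}.
  apply/allP; case: x y => [[|[|[|//]]] ?] [[|[|[|//]]] ?];
  rewrite /segs /a /ws /=; do ?[apply/andP; split=> //];
  by apply: T0; rewrite !inE !eqxx ?orbT.
(* The excepted cases are the row, entry (0, 1) of [route], against the column, entry (1, 2), in
   either order. *)
have apart (x y x' y' : 'I_3) : x != x' -> y != y' ->
    [|| [&& x == 0%N :> nat, y == 1%N :> nat, x' == 1%N :> nat & y' == 2%N :> nat],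
        [&& x == 1%N :> nat, y == 2%N :> nat, x' == 0%N :> nat & y' == 1%N :> nat]
      | all (fun s => all (fun s' => boxes_apart s.1 s.2 s'.1 s'.2) (segs x' y'))
          (segs x y)].
  case: x y x' y' => [[|[|[|//]]] ?] [[|[|[|//]]] ?] [[|[|[|//]]] ?] [[|[|[|//]]] ?];
  rewrite -!val_eqE // => _ _;
  by rewrite /boxes_apart /intervals_apart /= !gtn_max !leq_min; lia.
have [x y|x y|x [x' [y [y' [xx' yy' /hasP[z zp' zp]]]]]] :=
  free (h \o a) (h \o b) (fun x y => tour (a x) (ws x y)).
- exact: (tour_path (T x y)).1.
- rewrite /= (tour_path (T x y)).2; congr h.
  by case: x y => [[|[|[|//]]] ?] [[|[|[|//]]] ?].
have [s sxy zs] := on_seg _ _ _ zp; have [s' sxy' zs'] := on_seg _ _ _ zp'.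
have meet : ~~ boxes_apart s.1 s.2 s'.1 s'.2.
  have /andP[sT1 sT2] := seg_frame _ _ _ sxy; have /andP[sT1' sT2'] := seg_frame _ _ _ sxy'.
  by apply: geod_apart zs zs'; rewrite /= sT1 sT2 sT1' sT2'.
case/or3P: (apart _ _ _ _ xx' yy') => [/and4P[/eqP x0 /eqP y1 /eqP x1 /eqP y2]| |].
- move: sxy sxy'; rewrite /segs /a /ws x0 y1 x1 y2 /= !inE => /eqP sE /eqP sE'.
  by exists z; rewrite sE in zs; rewrite sE' in zs'.
- move=> /and4P[/eqP x1 /eqP y2 /eqP x0 /eqP y1].
  move: sxy sxy'; rewrite /segs /a /ws x0 y1 x1 y2 /= !inE => /eqP sE /eqP sE'.
  by exists z; rewrite sE in zs; rewrite sE' in zs'.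
- by move=> /allP/(_ s sxy)/allP/(_ s' sxy'); rewrite (negbTE meet).
Qed.

(** Rows of different index lie in separated boxes, and so do columns; hence a vertex common to row
    [i] and column [j] determines both indices. *)
Lemma frame_card : k33_free H -> (m ^ 2 <= #|H|)%N.
Proof.
move=> free.
have range (i : 'I_m) : (2 <= i + 2 < m + 2)%N by rewrite ltn_add2r ltn_ord leq_addl.
have [f fP] := choice (fun ij : 'I_m * 'I_m => geod_cross free (range ij.1) (range ij.2)).
suff f_inj : injective f.
  by rewrite -mulnn -[m in (m * m)%N]card_ord -card_prod; exact: leq_card f_inj.
move=> [i j] [i' j'] ff'.
have [zi zj] := fP (i, j); have [] := fP (i', j'); rewrite -ff' /= in zi zj * => zi' zj'.
have iT := frame_side (range i); have iT' := frame_side (range i').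
have jT := frame_side (range j); have jT' := frame_side (range j').
have ii' : ~~ boxes_apart (i + 2, 0)%N (i + 2, n.-1)%N (i' + 2, 0)%N (i' + 2, n.-1)%N.
  apply: geod_apart zi zi'; apply/and5P; split=> //;
    first [by apply: iT; rewrite !inE eqxx ?orbT|by apply: iT'; rewrite !inE eqxx ?orbT].
have jj' : ~~ boxes_apart (1, j + 2)%N (n, j + 2)%N (1, j' + 2)%N (n, j' + 2)%N.
  apply: geod_apart zj zj'; apply/and5P; split=> //;
    first [by apply: jT; rewrite !inE eqxx ?orbT|by apply: jT'; rewrite !inE eqxx ?orbT].
move: ii' jj'; rewrite /boxes_apart /intervals_apart /= !gtn_max !leq_min => ii' jj'.
by congr pair; apply: val_inj => /=; lia.
Qed.

End Frame.

(** * The grid is planar *)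

(** A unit interval with integer ends is determined, up to orientation, by its lower end. *)
Lemma minn_consecutive (a b c d : nat) : a = b.+1 \/ b = a.+1 -> c = d.+1 \/ d = c.+1 ->
  minn a b = minn c d -> (a = c /\ b = d) \/ (a = d /\ b = c).
Proof.
by case=> ->; case=> ->; rewrite ?(minn_idPl (leqnSn _)) ?(minn_idPr (leqnSn _)) => ->;
  [left|right|right|left].
Qed.

Section Grid.
Variable R : realType.

Lemma natr_add_inj (i j : nat) (s t : R) : 0 <= s < 1 -> 0 <= t < 1 ->
  i%:R + s = j%:R + t -> i = j /\ s = t.
Proof.
move=> s01 t01 E; suff ij : i = j by split=> //; move: E; rewrite ij => /addrI.
apply/eqP; rewrite eqn_leq.
by rewrite -[(i <= j)%N]ltnS -[(j <= i)%N]ltnS -2!(ltr_nat R) -2!natr1; lra.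
Qed.

Definition grid_pos (k : nat) (u : grid k) : R * R := (u.1%:R, u.2%:R).

Definition grid_arc (k : nat) (u v : grid k) (t : R) : R * R :=
  ((1 - t) * u.1%:R + t * v.1%:R, (1 - t) * u.2%:R + t * v.2%:R).

(** The integer parts give the lower end of the edge, and the one nonzero fractional part gives its
    direction, so a point inside an arc determines the edge. *)
Lemma grid_arc_interior (k : nat) (u v : grid k) (t : R) :
  edge u v -> t \in `]0, 1[ ->
  exists a b : R, [/\ grid_arc u v t = ((minn u.1 v.1)%:R + a, (minn u.2 v.2)%:R + b),
    0 <= a < 1, 0 <= b < 1
    & [/\ a = 0, b != 0, u.1 = v.1 :> nat & (u.2 = v.2.+1 :> nat) \/ (v.2 = u.2.+1 :> nat)]
      \/ [/\ a != 0, b = 0, u.2 = v.2 :> nat & (u.1 = v.1.+1 :> nat) \/ (v.1 = u.1.+1 :> nat)]].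
Proof.
rewrite in_itv /= /edge /= /grid_edge /grid_arc => uv t01.
case/orP: uv => /andP[/eqP -> /orP[]/eqP <-].
- exists 0, t; rewrite minnn (minn_idPl (leqnSn _)) -natr1; split; [congr pair; ring|lra|lra|].
  by left; split=> //; [lra|right].
- exists 0, (1 - t); rewrite minnn (minn_idPr (leqnSn _)) -natr1.
  split; [congr pair; ring|lra|lra|].
  by left; split=> //; [lra|left].
- exists t, 0; rewrite minnn (minn_idPl (leqnSn _)) -natr1; split; [congr pair; ring|lra|lra|].
  by right; split=> //; [lra|right].
- exists (1 - t), 0; rewrite minnn (minn_idPr (leqnSn _)) -natr1.
  split; [congr pair; ring|lra|lra|].
  by right; split=> //; [lra|left].
Qed.

Lemma planar_grid (k : nat) : planar R (grid k).
Proof.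
exists (@grid_pos k), (@grid_arc k); split.
- move=> [u1 u2] [v1 v2] [/eqP uv1 /eqP uv2].
  by rewrite !eqr_nat in uv1 uv2; congr pair; apply: val_inj; apply/eqP.
- move=> u v uv; split.
  + have affine (a b : R) : continuous (fun t : R => (1 - t) * a + t * b).
      move=> t; apply: cvgD; apply: cvgM; try exact: cvg_cst; last exact: cvg_id.
      by apply: cvgB; [exact: cvg_cst|exact: cvg_id].
    apply: continuous_subspaceT => t; exact: (cvg_pair (affine _ _ t) (affine _ _ t)).
  + move=> s t _ _ [E1 E2].
    have {E1} : (s - t) * (v.1%:R - u.1%:R) = 0 by lra.
    have {E2} : (s - t) * (v.2%:R - u.2%:R) = 0 by lra.
    move=> /eqP; rewrite mulf_eq0 subr_eq0 => /orP[/eqP //|]; rewrite subr_eq0 eqr_nat => uv2.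
    move=> /eqP; rewrite mulf_eq0 subr_eq0 => /orP[/eqP //|]; rewrite subr_eq0 eqr_nat => uv1.
    suff uv' : u = v by move: uv; rewrite uv' edge_irr.
    by case: u v uv1 uv2 {uv} => [u1 u2] [v1 v2] /= uv1 uv2; congr pair; apply: val_inj;
      apply/esym/eqP.
  + by rewrite /grid_arc subr0 !mul1r !mul0r !addr0.
  + by rewrite /grid_arc subrr !mul1r !mul0r !add0r.
  + by move=> t _; rewrite /grid_arc; congr pair; ring.
- move=> u v w uv t t01; have [a [b [-> a01 b01 ab]]] := grid_arc_interior uv t01.
  move=> [E1 E2]; rewrite /grid_pos /= -[w.1%:R]addr0 in E1; rewrite -[w.2%:R]addr0 in E2.
  have z01 : 0 <= (0 : R) < 1 by lra.
  have [_ a0] := natr_add_inj a01 z01 E1; have [_ b0] := natr_add_inj b01 z01 E2.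
  by case: ab => [[_ /eqP]|[/eqP]].
- move=> u v u' v' uv uv' neq s t s01 t01.
  have [a [b [-> a01 b01 ab]]] := grid_arc_interior uv s01.
  have [a' [b' [-> a01' b01' ab']]] := grid_arc_interior uv' t01.
  move=> [E1 E2]; apply: neq.
  have {E1} [m1 aa'] := natr_add_inj a01 a01' E1.
  have {E2} [m2 bb'] := natr_add_inj b01 b01' E2.
  have nat_eq : [/\ u.1 = u'.1 :> nat, u.2 = u'.2 :> nat, v.1 = v'.1 :> nat & v.2 = v'.2 :> nat]
      \/ [/\ u.1 = v'.1 :> nat, u.2 = v'.2 :> nat, v.1 = u'.1 :> nat & v.2 = u'.2 :> nat].
    rewrite -aa' -bb' in ab'.
    case: ab ab' => [[a0 b0 uv1 uv2]|[a0 b0 uv1 uv2]] [[a0' b0' uv1' uv2']|[a0' b0' uv1' uv2']];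
      [|by rewrite b0' eqxx in b0|by rewrite a0' eqxx in a0|].
    - rewrite uv1 uv1' !minnn in m1 *.
      by case: (minn_consecutive uv2 uv2' m2) => -[-> ->]; [left|right].
    - rewrite uv1 uv1' !minnn in m2 *.
      by case: (minn_consecutive uv2 uv2' m1) => -[-> ->]; [left|right].
  have pair_inj (w w' : grid k) : w.1 = w'.1 :> nat -> w.2 = w'.2 :> nat -> w = w'.
    by case: w w' => [w1 w2] [w1' w2'] /= ? ?; congr pair; apply: val_inj.
  case: nat_eq => -[? ? ? ?]; first by rewrite (pair_inj u u') // (pair_inj v v').
  by rewrite (pair_inj u v') // (pair_inj v u') // finset.setUC.
Qed.

End Grid.

(** * Terminals in the grid *)

Definition grid_coord (k : nat) (u : grid k) : nat * nat := (val u.1, val u.2).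

Lemma distl1_edge (k : nat) (u v w : grid k) : edge u w ->
  (distl1 (grid_coord u) (grid_coord v) <= (distl1 (grid_coord w) (grid_coord v)).+1)%N.
Proof.
rewrite /edge /= /grid_edge /distl1 /nat_dist /=.
by case/orP=> /andP[/eqP -> /orP[]/eqP <-]; lia.
Qed.

Lemma grid_step (k : nat) (u v : grid k) : u != v -> exists2 w : grid k, edge u w &
  distl1 (grid_coord u) (grid_coord v) = (distl1 (grid_coord w) (grid_coord v)).+1.
Proof.
case: u v => [u1 u2] [v1 v2]; rewrite xpair_eqE -!val_eqE /edge /= /grid_edge.
rewrite /distl1 /nat_dist /= => uv.
have [uv1|uv1|uv1] := ltngtP u1 v1.
- exists (Ordinal (leq_ltn_trans uv1 (ltn_ord v1)), u2); rewrite ?eqxx ?orbT //=; lia.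
- exists (Ordinal (leq_ltn_trans (leq_pred u1) (ltn_ord u1)), u2); last by rewrite /=; lia.
  by rewrite eqxx /= prednK ?eqxx ?orbT //; lia.
have [uv2|uv2|uv2] := ltngtP u2 v2.
- exists (u1, Ordinal (leq_ltn_trans uv2 (ltn_ord v2))); rewrite ?eqxx ?orbT //=; lia.
- exists (u1, Ordinal (leq_ltn_trans (leq_pred u2) (ltn_ord u2))); last by rewrite /=; lia.
  by rewrite eqxx /= prednK ?eqxx ?orbT //; lia.
by rewrite uv1 uv2 !eqxx in uv.
Qed.

Lemma distl1xx (u : nat * nat) : distl1 u u = 0%N.
Proof. by rewrite /distl1 /nat_dist !subnn. Qed.

Lemma grid_geodesic (k : nat) (u v : grid k) : exists p : seq (grid k),
  [/\ path edge u p, last u p = v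
    & size p = distl1 (grid_coord u) (grid_coord v)].
Proof.
have [d] := ubnP (distl1 (grid_coord u) (grid_coord v)).
elim: d u => // d IHd u ud.
have [->|/grid_step[w uw uvE]] := eqVneq u v; first by exists [::]; rewrite distl1xx.
have [|p [wp pv pE]] := IHd w; first by rewrite uvE in ud.
by exists (w :: p); split; [exact/andP| |rewrite uvE -pE].
Qed.

Lemma grid_path_size (k : nat) (u : grid k) (p : seq (grid k)) : path edge u p ->
  (distl1 (grid_coord u) (grid_coord (last u p)) <= size p)%N.
Proof.
elim: p u => [|w p IHp] u /=; first by rewrite distl1xx.
by move=> /andP[/distl1_edge uw /IHp wp]; apply: leq_trans (uw _) _; rewrite ltnS.
Qed.

Section UnitGrid.
Variable R : realType.

Definition unit_length (G : sgraph) (x y : G) : R := 1.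

Lemma edge_length_unit (G : sgraph) : edge_length (@unit_length G).
Proof. by move=> x y _; split. Qed.

Lemma path_length_unit (G : sgraph) (x : G) (p : seq G) :
  path_length (@unit_length G) x p = (size p)%:R.
Proof.
elim: p x => [|y p IHp] x; first by rewrite /path_length big_nil.
by rewrite path_length_cons IHp /= -natr1 addrC.
Qed.

Lemma dist_unit_grid (k : nat) (u v : grid k) :
  dist (@unit_length (grid k)) u v = (distl1 (grid_coord u) (grid_coord v))%:R%:E.
Proof.
apply/le_anti/andP; split.
  have [p [up pv <-]] := grid_geodesic u v.
  rewrite -(path_length_unit u p).
  exact: (dist_le_walk (@edge_length_unit (grid k)) up pv).
apply: le_ereal_inf_tmp => _ [p [up _ <-] <-].
by rewrite path_length_unit lee_fin ler_nat grid_path_size.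
Qed.

End UnitGrid.

(** This pads the frame to exactly [k] terminals. *)
Lemma superset_card (T : finType) (A : {set T}) (k : nat) : (#|A| <= k <= #|T|)%N ->
  exists2 B : {set T}, A \subset B & #|B| = k.
Proof.
move=> /andP[/subnKC <-]; elim: (k - #|A|)%N => [|d IHd] le_T.
  by exists A; rewrite ?addn0.
rewrite addnS in le_T *; have [B AB cB] := IHd (ltnW le_T).
have /card_gt0P[x] : (0 < #|~: B|)%N by have := cardsC B; lia.
rewrite finset.in_setC => xB; exists (x |: B)%SET; last by rewrite cardsU1 xB cB.
exact: (fintype.subset_trans AB (finset.subsetU1 _ _)).
Qed.

Lemma frame_range (n m : nat) (u : nat * nat) : (m + 3 <= n)%N -> u \in frame n m ->
  (u.1 <= n)%N && (u.2 <= n)%N.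
Proof.
move=> mn; rewrite mem_cat => /orP[|/flatten_mapP[i]].
  by rewrite !inE => /or4P[] /eqP ->; rewrite ?leqnn.
rewrite mem_iota => im uC.
have [i_le n_le one_le] : [/\ i <= n, n.-1 <= n & 1 <= n]%N by split; lia.
by rewrite !inE in uC; case/or4P: uC => /eqP -> /=; rewrite ?leqnn ?i_le ?n_le ?one_le.
Qed.

Lemma size_frame (n m : nat) : size (frame n m) = (4 + 4 * m)%N.
Proof.
rewrite size_cat; congr addn; rewrite -[in RHS](size_iota 2 m).
by elim: (iota 2 m) => //= _ s ->; rewrite mulnS.
Qed.

Lemma grid_terminals (R : realType) (k : nat) : (0 < k)%N ->
  exists2 S : {set grid k}, #|S| = k &
    forall (H : sgraph) (l : H -> H -> R) (iota : {x : grid k | x \in S} -> H),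
      k33_free H -> edge_length l -> preserves_dist (@unit_length R (grid k)) l iota ->
      (k ^ 2 <= 64 * #|vertex H|)%N.
Proof.
case: k => // n _.
have card_grid : #|grid n.+1| = (n.+1 * n.+1)%N by rewrite card_prod card_ord.
have small (S : {set grid n.+1}) (H : sgraph) (l : H -> H -> R)
    (iota : {x : grid n.+1 | x \in S} -> H) : #|S| = n.+1 ->
    preserves_dist (@unit_length R (grid n.+1)) l iota -> (n.+1 <= #|vertex H|)%N.
  by move=> cS [/leq_card + _]; rewrite card_sig cS; exact.
(* Up to 64, the terminals alone are numerous enough. *)
have [n64|n64] := leqP n.+1 64.
  have [|S _ cS] := @superset_card (grid n.+1) finset.set0 n.+1.
    by rewrite cards0 card_grid leq_pmulr.
  exists S => // H l iota _ _ /(small _ _ _ _ cS) Hn.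
  by rewrite -mulnn leq_mul.
(* The largest [m] for which the [4 + 4 * m] entries of the frame fit among [n.+1] terminals. *)
pose m := (n.+1 %/ 4).-1.
have mn : (m + 3 <= n)%N by rewrite /m; lia.
pose toG (u : nat * nat) : grid n.+1 := (inord u.1, inord u.2).
have toGK u : u \in frame n m -> grid_coord (toG u) = u.
  move=> /(frame_range mn)/andP[u1 u2].
  by rewrite /grid_coord /= !inordK ?ltnS //; case: u {u1 u2}.
pose T := [set x in map toG (frame n m)]%SET.
have [|S TS cS] := @superset_card (grid n.+1) T n.+1.
  rewrite card_grid leq_pmulr // andbT cardsE (leq_trans (card_size _)) //.
  by rewrite size_map size_frame /m; lia.
have uS u : u \in frame n m -> toG u \in S.
  by move=> uF; apply: (fintype.subsetP TS); rewrite finset.inE map_f.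
exists S => // H l iota free l_length [_ iota_dist].
(* A default terminal, which gives [h] a value where [toG u] is not in [S]. *)
have s0 : {x : grid n.+1 | x \in S}.
  by exists (toG (0, 0)%N); apply: uS; rewrite mem_cat mem_head.
pose h (u : nat * nat) := iota (insubd s0 (toG u)).
have h_dist u v : u \in frame n m -> v \in frame n m ->
    dist l (h u) (h v) = (distl1 u v)%:R%:E.
  move=> uF vF; rewrite iota_dist !insubdK ?dist_unit_grid ?toGK //; exact: uS.
have mH := frame_card l_length mn h_dist free.
apply: leq_trans (leq_mul (leqnn 64) mH).
(* As [n.+1] exceeds 64, the choice of [m] gives [n.+1 <= 8 * m]; squaring produces the constant
   64. *)
by rewrite -[64%N]/(8 ^ 2)%N -expnMn leq_sqr /m; lia.
Qed.

Theorem theorem6 (R : realType) :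
  exists2 c : R, 0 < c &
    forall k : nat, (0 < k)%N ->
      (exists (l : grid k -> grid k -> R) (S : {set grid k}),
        [/\ planar R (grid k), edge_length l, #|S| = k
          & forall (H : sgraph) (l' : H -> H -> R)
              (iota : {x : grid k | x \in S} -> H),
              planar R H -> edge_length l' ->
              preserves_dist l l' iota ->
              c * k%:R ^+ 2 <= #|vertex H|%:R]) /\
      ((c * k%:R ^+ 2)%:E <= fstar R (planar R) k)%E.

Proof.
exists 64^-1 => // k k0; have [S cS bound] := grid_terminals R k0.
have card_bound (n : nat) : (k ^ 2 <= 64 * n)%N -> 64^-1 * k%:R ^+ 2 <= n%:R :> R.
  by rewrite -(ler_nat R) natrX natrM => kn; lra.
split.
  exists (@unit_length R (grid k)), S; split=> //.
  - exact: planar_grid.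
  - by move=> H l iota /planar_k33_free free l_length /(bound _ _ _ free l_length)/card_bound.
apply: le_ereal_inf_tmp => _ [N dpN <-]; rewrite lee_fin.
have [H [l [[l_length [phi [iota [minor _ iota_dist]]]] HN]]] :=
  dpN _ _ S (planar_grid R k) (@edge_length_unit R (grid k)) cS.
(* [k33_free] passes from the grid to the minor by lifting walks, in place of a plane drawing of the
   minor. *)
have free := minor_k33_free minor (planar_k33_free (planar_grid R k)).
apply: le_trans (card_bound _ (bound _ _ _ free l_length iota_dist)) _.
by rewrite ler_nat.
Qed.
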